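(* Let $\Gamma'$ be the fundamental group of a non-orientable two-dimensional orbifold, which is neither $\mathbb{RP}^2$ nor the Klein bottle, presented as in the context. Then the infinite order reversible elements of $\Gamma'$ are conjugate to elements of the form $c_i^{\mu_i/2}\,k\,c_j^{\mu_j/2}\,k^{-1}$, where $\mu_i$ and $\mu_j$ are even and $k\in\Gamma'$.
   Context: An element $a$ of a group $\Gamma$ is reversible if there is $g\in\Gamma$ with $gag^{-1}=a^{-1}$. The group has presentation $$\Gamma'=\Big\langle x_i,c_i,d_i\ \Big|\ c_i^{\mu_i}=1,\ \prod x_i^2\prod c_i\prod d_i=1\Big\rangle,$$ where the $x_i$ generate the crosscaps, the $d_i$ correspond to boundary components, and the $c_i$ correspond to the cone points, of order $\mu_i$. Standing assumption: $\Gamma'$ is a discrete subgroup of $\mathrm{PGL}(2,\mathbb R)$, acting by isometries on the hyperbolic plane. *)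

(* Defs.v *)
From HB Require Import structures.
From mathcomp Require Import all_boot all_order all_algebra.
From mathcomp Require Import generic_quotient.
From mathcomp Require Import all_classical all_reals all_analysis.

Set Implicit Arguments.
Unset Strict Implicit.
Unset Printing Implicit Defensive.

Import Order.TTheory GRing.Theory Num.Theory.
Import numFieldNormedType.Exports.

(* The library's [{unit R}] and ['GL_n[R]] require a finite ring R. *)
Record GL (R : realType) (n : nat) := MkGL {
  GL_mx : 'M[R]_n;
  GL_unitmx : GL_mx \in unitmx
}.

Section GLGroup.
Variables (R : realType) (n : nat).
Local Open Scope ring_scope.
Implicit Types A B C : GL R n.

HB.instance Definition _ := [isSub for @GL_mx R n].
HB.instance Definition _ := [Choice of GL R n by <:].
HB.instance Definition _ :=
  Topological.copy (GL R n) (initial_topology (@GL_mx R n)).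

Definition GL_one : GL R n := MkGL (unitmx1 R n).

Fact GL_mul_subproof A B : GL_mx A *m GL_mx B \in unitmx.
Proof. by rewrite unitmx_mul !GL_unitmx. Qed.
Definition GL_mul A B : GL R n := MkGL (GL_mul_subproof A B).

Fact GL_inv_subproof A : invmx (GL_mx A) \in unitmx.
Proof. by rewrite unitmx_inv GL_unitmx. Qed.
Definition GL_inv A : GL R n := MkGL (GL_inv_subproof A).

Fact GL_mulA : associative GL_mul.
Proof. by move=> A B C; apply: val_inj; rewrite /= mulmxA. Qed.
Fact GL_mul1 : left_id GL_one GL_mul.
Proof. by move=> A; apply: val_inj; rewrite /= mul1mx. Qed.
Fact GL_mulr1 : right_id GL_one GL_mul.
Proof. by move=> A; apply: val_inj; rewrite /= mulmx1. Qed.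
Fact GL_mulV : left_inverse GL_one GL_inv GL_mul.
Proof. by move=> A; apply: val_inj; rewrite /= mulVmx ?GL_unitmx. Qed.
Fact GL_mulrV : right_inverse GL_one GL_inv GL_mul.
Proof. by move=> A; apply: val_inj; rewrite /= mulmxV ?GL_unitmx. Qed.

HB.instance Definition _ := isGroup.Build (GL R n)
  GL_mulA GL_mul1 GL_mulr1 GL_mulV GL_mulrV.

End GLGroup.

Section PGLDef.
Variables (R : realType) (n : nat).
Local Open Scope ring_scope.
Implicit Types A B C : GL R n.

Definition proportional : rel (GL R n) :=
  fun A B => `[< exists2 l : R, l != 0 & GL_mx A = l *: GL_mx B >].

Fact proportional_refl : reflexive proportional.
Proof. by move=> A; apply/asboolP; exists 1; rewrite ?oner_neq0 ?scale1r. Qed.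
Fact proportional_trans : transitive proportional.
Proof.
move=> B A C /asboolP[l l0 AB] /asboolP[m m0 BC]; apply/asboolP.
by exists (l * m); rewrite ?mulf_neq0// AB BC scalerA.
Qed.
Fact proportional_sym : symmetric proportional.
Proof.
have sym A B : proportional A B -> proportional B A.
  move=> /asboolP[l l0 AB]; apply/asboolP; exists l^-1; rewrite ?invr_neq0//.
  by rewrite AB scalerA mulVf// scale1r.
by move=> A B; apply/idP/idP; exact: sym.
Qed.

Canonical proportional_equiv :=
  EquivRel proportional proportional_refl proportional_sym proportional_trans.

Local Open Scope quotient_scope.

(* GL(n, R) modulo nonzero scalars, with the quotient topology. *)
Definition PGL : Type := quotient_topology {eq_quot proportional}.

HB.instance Definition _ := Quotient.on PGL.
HB.instance Definition _ := Topological.on PGL.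

Lemma PGL_eqP A B : reflect (\pi_PGL A = \pi_PGL B) (proportional A B).
Proof.
exact: (@eqmodP _ proportional_equiv A B).
Qed.

Definition PGL_one : PGL := \pi_PGL (1 : GL R n)%g.
Definition PGL_mul (u v : PGL) : PGL := \pi_PGL (repr u * repr v)%g.
Definition PGL_inv (u : PGL) : PGL := \pi_PGL (repr u)^-1%g.

Lemma proportional_repr A : proportional (repr (\pi_PGL A)) A.
Proof. by apply/PGL_eqP; rewrite reprK. Qed.

Lemma PGL_mulE A B : PGL_mul (\pi_PGL A) (\pi_PGL B) = \pi_PGL (A * B)%g.
Proof.
apply/PGL_eqP/asboolP.
have /asboolP[l l0 EA] := proportional_repr A.
have /asboolP[m m0 EB] := proportional_repr B.
exists (l * m); first by rewrite mulf_neq0.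
by rewrite /= EA EB -scalemxAl -scalemxAr scalerA.
Qed.

Lemma PGL_invE A : PGL_inv (\pi_PGL A) = \pi_PGL A^-1%g.
Proof.
apply/PGL_eqP/asboolP; have /asboolP[l l0 EA] := proportional_repr A.
exists l^-1; first by rewrite invr_neq0.
by rewrite /= EA invmxZ ?unitmxZ ?unitfE ?GL_unitmx.
Qed.

Fact PGL_mulA : associative PGL_mul.
Proof.
suff piA A B C : PGL_mul (\pi A) (PGL_mul (\pi B) (\pi C)) =
                 PGL_mul (PGL_mul (\pi A) (\pi B)) (\pi C).
  by move=> u v w; have := piA (repr u) (repr v) (repr w); rewrite !reprK.
by rewrite (PGL_mulE B C) (PGL_mulE A B) (PGL_mulE A) (PGL_mulE _ C) mulgA.
Qed.
Fact PGL_mul1 : left_id PGL_one PGL_mul.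
Proof. by move=> u; rewrite -[in LHS](reprK u) PGL_mulE mul1g reprK. Qed.
Fact PGL_mulr1 : right_id PGL_one PGL_mul.
Proof. by move=> u; rewrite -[in LHS](reprK u) PGL_mulE mulg1 reprK. Qed.
Fact PGL_mulV : left_inverse PGL_one PGL_inv PGL_mul.
Proof.
by move=> u; rewrite -[in X in PGL_mul _ X](reprK u) PGL_mulE mulVg.
Qed.
Fact PGL_mulrV : right_inverse PGL_one PGL_inv PGL_mul.
Proof.
by move=> u; rewrite -[in X in PGL_mul X _](reprK u) PGL_mulE mulgV.
Qed.

HB.instance Definition _ := isGroup.Build PGL
  PGL_mulA PGL_mul1 PGL_mulr1 PGL_mulV PGL_mulrV.

End PGLDef.

Local Open Scope group_scope.

Definition discrete_subgroup (R : realType) (n : nat)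
    (H : groupClosed (PGL R n)) : Prop :=
  ([set` H] `<=` isolated [set` H])%classic.

(* Words in the letters [i] (encoded [(i, false)]) and their formal inverses
   (encoded [(i, true)]). *)
Definition word (I : Type) := seq (I * bool).

Definition eval_word (G : groupType) (I : Type) (s : I -> G) (w : word I) : G :=
  \prod_(l <- w) (if l.2 then (s l.1)^-1 else s l.1).

(* Equality in the group with generating set [I] and relators [rels]. *)
Inductive word_eqv (I : Type) (rels : word I -> Prop) : word I -> word I -> Prop :=
| WordRefl w : word_eqv rels w w
| WordSym w1 w2 : word_eqv rels w1 w2 -> word_eqv rels w2 w1
| WordTrans w1 w2 w3 :
    word_eqv rels w1 w2 -> word_eqv rels w2 w3 -> word_eqv rels w1 w3
| WordCancel u v i e :
    word_eqv rels (u ++ (i, e) :: (i, ~~ e) :: v) (u ++ v)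
| WordRelator u v r : rels r -> word_eqv rels (u ++ r ++ v) (u ++ v).

(* The subgroup [H] has the presentation < I | rels >, with [i] standing for
   the element [s i]. *)
Definition has_presentation (G : groupType) (H : groupClosed G)
    (I : Type) (s : I -> G) (rels : word I -> Prop) : Prop :=
  [/\ forall i, s i \in H,
      forall a, a \in H -> exists w, a = eval_word s w
    & forall w, eval_word s w = 1 <-> word_eqv rels w [::]].

Inductive orbifold_gen (g r b : nat) : Type :=
| Crosscap of 'I_g
| Cone of 'I_r
| Boundary of 'I_b.
Arguments Crosscap {g r b}.
Arguments Cone {g r b}.
Arguments Boundary {g r b}.

Definition orbifold_gen_val (G : Type) (g r b : nat)
    (x : 'I_g -> G) (c : 'I_r -> G) (d : 'I_b -> G)
    (z : orbifold_gen g r b) : G :=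
  match z with Crosscap i => x i | Cone i => c i | Boundary i => d i end.

Definition surface_word (g r b : nat) : word (orbifold_gen g r b) :=
  flatten [seq [:: (Crosscap i, false); (Crosscap i, false)] | i <- enum 'I_g]
  ++ [seq (Cone i, false) | i <- enum 'I_r]
  ++ [seq (Boundary i, false) | i <- enum 'I_b].

Inductive orbifold_relator (g r b : nat) (mu : 'I_r -> nat) :
    word (orbifold_gen g r b) -> Prop :=
| ConeRelator i : orbifold_relator mu (nseq (mu i) (Cone i, false))
| SurfaceRelator : orbifold_relator mu (surface_word g r b).

(* The discrete group [H] is the fundamental group of the non-orientable
   orbifold with [g] crosscaps, [r] cone points of orders [mu] and [b] boundary
   components, on the generators [x], [c], [d]. *)
Definition nonorientable_orbifold_group (R : realType)
    (H : groupClosed (PGL R 2)) (g r b : nat) (mu : 'I_r -> nat)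
    (x : 'I_g -> PGL R 2) (c : 'I_r -> PGL R 2) (d : 'I_b -> PGL R 2) : Prop :=
  [/\ discrete_subgroup H,
      (0 < g)%N,
      forall i, (1 < mu i)%N
    & has_presentation H (orbifold_gen_val x c d) (orbifold_relator mu)].

Definition reversible_in (G : groupType) (H : groupClosed G) (a : G) : Prop :=
  exists2 g, g \in H & g * a * g^-1 = a^-1.

Definition infinite_order (G : groupType) (a : G) : Prop :=
  forall m : nat, (0 < m)%N -> a ^+ m <> 1.

(* Main.v *)
Require Import Defs.
From mathcomp Require Import all_boot all_order all_algebra.
From mathcomp Require Import all_classical all_reals all_analysis.
From HB Require Import structures.
From mathcomp Require Import zify ring.

(* If [t a t^-1 = a^-1] in PGL(2) and [a^2 <> 1], then a lift of [t] is
   traceless, so [t^2 = 1] and [a = t (t a)] is a product of two involutions.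
   It remains to show that every involution of [Gamma] is conjugate to some
   [c_i^(mu_i/2)].  Writing the surface relation as [x_0^2 w = 1], [Gamma] is
   the amalgam of [<x_0>] and of the subgroup [K] generated by the other
   generators over [<w>], and [K] is the free product of the cyclic groups they
   generate; both facts follow from the presentation by letting words act on
   normal forms built out of elements of [Gamma].  By cyclic reduction an
   involution is then conjugate into [<x_0>], which is torsion-free unless it is
   all of [Gamma] and finite, or into a cyclic factor of [K], whose order is read
   off a homomorphism to a cyclic group. *)

Set Implicit Arguments.
Unset Strict Implicit.
Unset Printing Implicit Defensive.

Import Order.TTheory GRing.Theory Num.Theory.

(** * Reversible elements of PGL(2) *)

Section PGL2.
Variable R : realType.
Local Open Scope ring_scope.
Local Open Scope quotient_scope.

Lemma mulmx2E (A B : 'M[R]_2) i j :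
  (A *m B) i j = A i ord0 * B ord0 j + A i ord_max * B ord_max j.
Proof.
rewrite !mxE !big_ord_recl big_ord0 addr0.
by have -> : lift ord0 ord0 = ord_max :> 'I_2 by exact: val_inj.
Qed.

Lemma matrix2P (A B : 'M[R]_2) :
  A ord0 ord0 = B ord0 ord0 -> A ord0 ord_max = B ord0 ord_max ->
  A ord_max ord0 = B ord_max ord0 -> A ord_max ord_max = B ord_max ord_max ->
  A = B.
Proof.
move=> e00 e01 e10 e11; apply/matrixP => i j.
have I2 (k : 'I_2) : k = ord0 \/ k = ord_max.
  by case: k => [[|[|//]] lk]; [left | right]; exact: val_inj.
by have [->|->] := I2 i; have [->|->] := I2 j.
Qed.

Lemma det_mx2 (A : 'M[R]_2) :
  \det A = A ord0 ord0 * A ord_max ord_max - A ord0 ord_max * A ord_max ord0.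
Proof.
have e1 : lift ord0 ord0 = ord_max :> 'I_2 by exact: val_inj.
have e0 : lift ord_max ord0 = ord0 :> 'I_2 by exact: val_inj.
rewrite (expand_det_row _ ord0) !big_ord_recl big_ord0 addr0 /cofactor !det_mx11.
by rewrite !mxE !e1 !e0 /= expr0 expr1 mul1r mulN1r mulrN.
Qed.

(* [A B A = l B] entrywise, for [A] = (p q; r s) and [B] = (e f; k h). *)
Lemma twisted_commutation2 (p q r s e f k h l : R) :
  p * s - q * r != 0 -> e * h - f * k != 0 ->
  (p * e + q * k) * p + (p * f + q * h) * r = l * e ->
  (p * e + q * k) * q + (p * f + q * h) * s = l * f ->
  (r * e + s * k) * p + (r * f + s * h) * r = l * k ->
  (r * e + s * k) * q + (r * f + s * h) * s = l * h ->
  [\/ p + s = 0, [/\ q = 0, r = 0 & p = s] | e + h = 0].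
Proof.
set D := p * s - q * r; set d := e * h - f * k.
move=> D0 d0 E11 E12 E21 E22.
(* Determinants of the two sides of [A B A = l B] give [D^2 d = l^2 d]. *)
have lD : (l - D) * (l + D) = 0.
  apply: (mulIf d0); rewrite mul0r.
  have -> : (l - D) * (l + D) * d = (l * e) * (l * h) - (l * f) * (l * k) - D ^+ 2 * d.
    by rewrite /D /d; ring.
  by rewrite -E11 -E12 -E21 -E22 /D /d; ring.
(* [D BA = l adj(A) B], entrywise. *)
have F11 : D * (e * p + f * r) = l * (s * e - q * k).
  have -> : l * (s * e - q * k) = s * (l * e) - q * (l * k) by ring.
  by rewrite -E11 -E21 /D; ring.
have F12 : D * (e * q + f * s) = l * (s * f - q * h).
  have -> : l * (s * f - q * h) = s * (l * f) - q * (l * h) by ring.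
  by rewrite -E12 -E22 /D; ring.
have F21 : D * (k * p + h * r) = l * (p * k - r * e).
  have -> : l * (p * k - r * e) = p * (l * k) - r * (l * e) by ring.
  by rewrite -E11 -E21 /D; ring.
have F22 : D * (k * q + h * s) = l * (p * h - r * f).
  have -> : l * (p * h - r * f) = p * (l * h) - r * (l * f) by ring.
  by rewrite -E12 -E22 /D; ring.
have [lE|lE] : l = D \/ l = - D.
- move/eqP: lD; rewrite mulf_eq0 subr_eq0 addr_eq0.
  by case/orP => /eqP; [left | right].
- move: F11 F12 F21 F22; rewrite lE.
  move=> /(mulfI D0) F11 /(mulfI D0) F12 /(mulfI D0) F21 /(mulfI D0) F22.
  (* Now [B A = adj(A) B]: its off-diagonal entries, and the difference of its diagonal ones, show
     that the trace [e + h] of [B] kills [q], [r] and [p - s]. *)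
  have [eh0|eh0] := eqVneq (e + h) 0; first exact: Or33.
  apply: Or32; split; apply: (mulIf eh0); rewrite ?mul0r.
  + have -> : q * (e + h) = (e * q + f * s) - (s * f - q * h) by ring.
    by rewrite F12 subrr.
  + have -> : r * (e + h) = (k * p + h * r) - (p * k - r * e) by ring.
    by rewrite F21 subrr.
  + have -> : p * (e + h) = s * (e + h) + ((e * p + f * r) - (s * e - q * k))
       - ((k * q + h * s) - (p * h - r * f)) by ring.
    by rewrite F11 F22 !subrr addr0 subr0.
- have cancel x y : D * x = - D * y -> x + y = 0.
    by rewrite mulNr -mulrN => /(mulfI D0) ->; rewrite addNr.
  move: F11 F12 F21 F22; rewrite lE => /cancel F11 /cancel F12 /cancel F21 /cancel F22.
  apply: Or31; apply: (mulIf d0); rewrite mul0r.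
  have two0 : 2%:R != 0 :> R by rewrite pnatr_eq0.
  apply: (mulfI two0); rewrite mulr0.
  (* the trace of [adj(B) (BA + adj(A) B)] *)
  have -> : 2%:R * ((p + s) * d) =
    h * ((e * p + f * r) + (s * e - q * k)) - f * ((k * p + h * r) + (p * k - r * e))
    - k * ((e * q + f * s) + (s * f - q * h)) + e * ((k * q + h * s) + (p * h - r * f)).
    by rewrite /d; ring.
  by rewrite F11 F12 F21 F22 !mulr0 !subr0 addr0.
Qed.

(** By Cayley-Hamilton a traceless [A] has the scalar square [- det A]. *)
Lemma PGL2_traceless_involution (A : GL R 2) :
  GL_mx A ord0 ord0 + GL_mx A ord_max ord_max = 0 ->
  (\pi_(PGL R 2) A * \pi_(PGL R 2) A = 1)%g.
Proof.
move=> trA; have := Defs.GL_unitmx A.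
rewrite unitmxE unitfE det_mx2; set D := _ - _ => D0.
have sE : GL_mx A ord_max ord_max = - GL_mx A ord0 ord0.
  by apply/eqP; rewrite -addr_eq0 addrC trA.
rewrite [LHS]PGL_mulE; apply/PGL_eqP/asboolP; exists (- D); first by rewrite oppr_eq0.
by apply: matrix2P; rewrite mulmx2E !mxE /D sE /=; ring.
Qed.

Lemma PGL2_scalar (A : GL R 2) :
  GL_mx A ord0 ord_max = 0 -> GL_mx A ord_max ord0 = 0 ->
  GL_mx A ord0 ord0 = GL_mx A ord_max ord_max -> \pi_(PGL R 2) A = 1%g.
Proof.
move=> q0 r0 ps; have := Defs.GL_unitmx A.
rewrite unitmxE unitfE det_mx2 q0 mul0r subr0 -ps mulf_eq0 orbb => p0.
apply/PGL_eqP/asboolP; exists (GL_mx A ord0 ord0) => //.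
by apply: matrix2P; rewrite !mxE /= ?q0 ?r0 -?ps ?mulr1 ?mulr0.
Qed.

(** Lifts satisfy [A B A = l B]. A traceless [A] would make [a] an involution and a scalar one would
    make it trivial, so the lift [B] of [g] is traceless. *)
Lemma PGL2_reversor_involution (a g : PGL R 2) :
  (a * a <> 1 -> g * a * g^-1 = a^-1 -> g * g = 1)%g.
Proof.
have lift (u : PGL R 2) : exists A, u = \pi_(PGL R 2) A by exists (repr u); rewrite reprK.
move=> aa1 gag; have : (a * g * a = g)%g.
  by rewrite -mulgA -[X in (_ * X)%g](mulgVK g) gag mulVKg.
have [A aE] := lift a; have [B gE] := lift g; subst a g.
have -> : (\pi_(PGL R 2) A * \pi_(PGL R 2) B * \pi_(PGL R 2) A)%g = \pi_(PGL R 2) (A * B * A)%g.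
  by rewrite -[RHS]PGL_mulE -(PGL_mulE A B).
move=> /PGL_eqP/asboolP[l _ /= ABA].
have ent i j : (GL_mx A *m GL_mx B *m GL_mx A) i j = l * GL_mx B i j.
  by rewrite ABA mxE.
have := @twisted_commutation2 _ _ _ _ _ _ _ _ l.
have := Defs.GL_unitmx A; have := Defs.GL_unitmx B; rewrite !unitmxE !unitfE !det_mx2.
move=> B0 A0 /(_ _ _ _ _ _ _ _ _ A0 B0).
have := ent ord0 ord0; have := ent ord0 ord_max.
have := ent ord_max ord0; have := ent ord_max ord_max.
rewrite !mulmx2E => E22 E21 E12 E11 /(_ E11 E12 E21 E22).
case=> [trA|[q0 r0 ps]|]; last exact: PGL2_traceless_involution.
- by case: aa1; exact: PGL2_traceless_involution.
- by case: aa1; rewrite (PGL2_scalar q0 r0 ps) mul1g.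
Qed.

End PGL2.

Local Open Scope group_scope.

(** * Words, powers and amalgams *)

Section Words.
Variables (G : groupType) (I : Type) (s : I -> G).

Lemma eval_word_nil : eval_word s [::] = 1.
Proof. exact: big_nil. Qed.

Lemma eval_word_cons l w :
  eval_word s (l :: w) = (if l.2 then (s l.1)^-1 else s l.1) * eval_word s w.
Proof. exact: big_cons. Qed.

Lemma eval_word_cat u v : eval_word s (u ++ v) = eval_word s u * eval_word s v.
Proof. exact: big_cat. Qed.

Lemma eval_word_nseq n i e :
  eval_word s (nseq n (i, e)) = (if e then (s i)^-1 else s i) ^+ n.
Proof.
elim: n => [|n IHn]; first exact: eval_word_nil.
by rewrite /= eval_word_cons IHn -expgS.
Qed.

Definition inv_word (w : word I) : word I := rev [seq (l.1, ~~ l.2) | l <- w].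

Lemma eval_inv_word w : eval_word s (inv_word w) = (eval_word s w)^-1.
Proof.
elim: w => [|[i e] w IHw]; first by rewrite !eval_word_nil invg1.
rewrite /inv_word /= rev_cons -cats1 eval_word_cat IHw !eval_word_cons.
by rewrite eval_word_nil mulg1 invgM /=; case: e => /=; rewrite ?invgK.
Qed.

End Words.

(** * Actions of a presented group on normal forms *)

Section WordAction.
Variables (I S : Type) (V : S -> Prop) (act : I * bool -> S -> S).
Hypothesis act_closed : forall l x, V x -> V (act l x).
Hypothesis actK : forall i e x, V x -> act (i, e) (act (i, ~~ e) x) = x.

Definition act_word (w : word I) (x : S) : S := foldr act x w.

Lemma act_word_cat u v x : act_word (u ++ v) x = act_word u (act_word v x).
Proof. exact: foldr_cat. Qed.

Lemma act_word_closed w x : V x -> V (act_word w x).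
Proof. by move=> Vx; elim: w => //= l w; exact: act_closed. Qed.

(** This separates elements: a word of value 1 must fix every normal form. The laws are asked on [V]
    only, since letters need not act invertibly on lists that are not normal forms. *)
Lemma act_word_eqv (rels : word I -> Prop) :
  (forall r x, rels r -> V x -> act_word r x = x) ->
  forall u v, word_eqv rels u v -> forall x, V x -> act_word u x = act_word v x.
Proof.
move=> act_rel u v; elim=> {u v}
  [//|u v _ IH x Vx|u1 u2 u3 _ IH1 _ IH2 x Vx|u v i e x Vx|u v r rr x Vx].
- by rewrite IH.
- by rewrite IH1// IH2.
- rewrite !act_word_cat /= actK//.
  exact: act_word_closed.
- rewrite !act_word_cat (act_rel r)//.
  exact: act_word_closed.
Qed.

End WordAction.

Section Powers.
Variable G : groupType.
Implicit Types a h k : G.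

(** The cyclic subgroup generated by [a]; integer powers are quotients of natural ones. *)
Definition powers a h : Prop := exists m n, h = a ^+ m / a ^+ n.

Lemma commute_expg a m n : a ^+ m * a ^+ n = a ^+ n * a ^+ m.
Proof. by rewrite -!expgnDr addnC. Qed.

Lemma powers_expg a n : powers a (a ^+ n).
Proof. by exists n, 0; rewrite expg0 divg1. Qed.

Lemma powers1 a : powers a 1.
Proof. exact: (powers_expg a 0). Qed.

Lemma powers_id a : powers a a.
Proof. exact: (powers_expg a 1). Qed.

Lemma powersV a h : powers a h -> powers a h^-1.
Proof. by move=> [m [n ->]]; exists n, m; rewrite invgF. Qed.

Lemma powersM a h k : powers a h -> powers a k -> powers a (h * k).
Proof.
move=> [m [n ->]] [p [q ->]]; exists (m + p), (n + q).
have npC : (a ^+ n)^-1 * a ^+ p = a ^+ p / a ^+ n.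
  by apply: commute_sym; apply: commuteV; exact: commute_expg.
apply: (mulIg (a ^+ (n + q))); rewrite mulgVK [in LHS](addnC n) !expgnDr !mulgA.
by rewrite mulgVK -(mulgA _ _ (a ^+ p)) npC !mulgA mulgVK.
Qed.

Lemma expg_eq_torsion a m n :
  a ^+ m = a ^+ n -> m != n -> exists2 k, 0 < k & a ^+ k = 1.
Proof.
wlog lmn : m n / m < n.
  move=> wl amn; case: ltngtP => // lt _; first by apply: (wl m n); rewrite ?ltn_eqF.
  by apply: (wl n m); rewrite ?ltn_eqF.
move=> amn _; exists (n - m); first by rewrite subn_gt0.
by rewrite expgnFr 1?ltnW// -amn mulgV.
Qed.

Lemma powers_torsion a h (k : nat) :
  powers a h -> h != 1 -> 0 < k -> h ^+ k = 1 -> exists2 n, 0 < n & a ^+ n = 1.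
Proof.
move=> [m [n ->]] h1 k0.
rewrite expgnFl; last exact: commute_expg.
rewrite -!expgnA => /divg1_eq /expg_eq_torsion; apply.
rewrite eqn_pmul2r//; apply: contraNneq h1 => ->.
by rewrite mulgV.
Qed.

Lemma powers_expg_eq1 a h n : a ^+ n = 1 -> powers a h -> h ^+ n = 1.
Proof.
move=> an [p [q ->]]; rewrite expgnFl; last exact: commute_expg.
by rewrite !(expgnAC a _ n) an !expg1n mulgV.
Qed.

Lemma powers_finite a h n :
  0 < n -> a ^+ n = 1 -> powers a h -> exists m, h = a ^+ m.
Proof.
(* As [a ^+ n = 1], the inverse of [a ^+ q] is [a ^+ (q * n.-1)]. *)
move=> n0 an [p [q ->]]; exists (p + q * n.-1).
rewrite expgnDr; congr (_ * _); apply: mulg1_eq.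
by rewrite -expgnDr -mulnS prednK// mulnC expgnA an expg1n.
Qed.

End Powers.

(** * Involutions in an amalgamated product *)

Section InternalAmalgam.
Variables (G : groupType) (I : eqType).
Implicit Type L : seq (I * G).

Definition list_prod L : G := \prod_(p <- L) p.2.

(** Reduced expressions of an amalgam over [C]; for [C = pred1 1] these are the normal forms of a
    free product. *)
Definition reduced (C : pred G) L : bool :=
  sorted (fun p q => p.1 != q.1) L && all (fun p => ~~ C p.2) L.

Variables (H : I -> G -> Prop) (C : pred G) (P : G -> Prop).
Hypothesis HM : forall i h k, H i h -> H i k -> H i (h * k).
Hypothesis CH : forall i c h, C c -> H i h -> H i (c * h).
Hypothesis P1 : P 1.
Hypothesis PV : forall h, P h -> P h^-1.
Hypothesis PM : forall h k, P h -> P k -> P (h * k).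
Hypothesis HP : forall i h, H i h -> P h.
Hypothesis reduced_neq1 : forall L, reduced C L -> L != [::] ->
  (forall p, p \in L -> H p.1 p.2) -> list_prod L != 1.

Lemma list_prod_cons p L : list_prod (p :: L) = p.2 * list_prod L.
Proof. exact: big_cons. Qed.

Lemma list_prod_cat L L' : list_prod (L ++ L') = list_prod L * list_prod L'.
Proof. exact: big_cat. Qed.

(** Pairs that can be merged into one factor: an element of [C] is absorbed by its right neighbour,
    whatever the index of the latter. *)
Let bad (p q : I * G) := (p.1 == q.1) || C p.2.

Let bad_merge p q : bad p q -> H p.1 p.2 -> H q.1 q.2 -> H q.1 (p.2 * q.2).
Proof. by case/orP => [/eqP <-|Cp] Hp Hq; [exact: HM | exact: CH]. Qed.

Let not_path_bad p L : ~~ path (fun p q => ~~ bad p q) p L ->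
  exists L1 q q' L2, p :: L = L1 ++ q :: q' :: L2 /\ bad q q'.
Proof.
elim: L p => //= q L IHL p; rewrite negb_and negbK => /orP[bpq|/IHL].
  by exists [::], p, q, L.
by move=> [L1 [a [b [L2 [E bab]]]]]; exists (p :: L1), a, b, L2; rewrite E.
Qed.

(** The path returns to [p], so it also controls the junction of the two copies, and every factor is
    the first member of some pair that is not bad. *)
Let not_bad_reduced p L :
  path (fun p q => ~~ bad p q) p (rcons L p) -> reduced C (p :: L ++ p :: L).
Proof.
move=> pp.
have pp2 : path (fun p q => ~~ bad p q) p (L ++ p :: rcons L p).
  by rewrite -cat_rcons cat_path pp last_rcons pp.
rewrite /reduced; apply/andP; split.
  have : path (fun p q => p.1 != q.1) p (L ++ p :: rcons L p).
    by apply: sub_path pp2 => q q'; rewrite negb_or => /andP[].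
  by rewrite -rcons_cons -rcons_cat rcons_path => /andP[].
have : all (fun p => ~~ C p.2) (p :: L).
  elim: L {pp2} p (X in rcons _ X) pp => [|q L IHL] p p' /= /andP[].
    by rewrite negb_or => /andP[_ ->].
  by rewrite negb_or => /andP[_ ->] /IHL.
by move=> /= /andP[Cp CL]; rewrite all_cat /= Cp CL.
Qed.

(* A product that is not cyclically reduced is conjugate to a shorter one, and
   the square of a cyclically reduced one is a reduced product, hence not 1. *)
Lemma involution_conj_factor L :
  (forall p, p \in L -> H p.1 p.2) -> list_prod L != 1 ->
  list_prod L * list_prod L = 1 ->
  exists i v, P v /\ H i (v^-1 * list_prod L * v).
Proof.
have [n] := ubnP (size L); elim: n => // n IHn in L *.
case: L => [|p L]; first by rewrite /list_prod big_nil eqxx.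
case: (lastP L) => [_ Hp _ _|{}L q].
  exists p.1, 1; split=> //; rewrite invg1 mul1g mulg1 list_prod_cons.
  by rewrite /list_prod big_nil mulg1; apply: Hp; rewrite mem_head.
rewrite ltnS => leLn Hin prod1 prodsq.
have [pp|/not_path_bad] := boolP (path (fun p q => ~~ bad p q) p (rcons L q)); last first.
  move=> [L1 [a [b [L2 [E bab]]]]].
  have prodE : list_prod (p :: rcons L q) = list_prod (L1 ++ (b.1, a.2 * b.2) :: L2).
    by rewrite E !list_prod_cat !list_prod_cons /= !mulgA.
  rewrite prodE in prod1 prodsq *; apply: IHn => //.
    move: leLn; rewrite E !size_cat /=; lia.
  move=> c; rewrite mem_cat inE => /or3P[cL1|/eqP ->|cL2].
  - by apply: Hin; rewrite E mem_cat cL1.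
  - by apply: (bad_merge bab); apply: Hin; rewrite E mem_cat !inE eqxx ?orbT.
  - by apply: Hin; rewrite E mem_cat !inE cL2 !orbT.
(* Conjugation by the last factor [q] brings it in front of [p], where the two merge. *)
have [bqp|gqp] := boolP (bad q p).
  have Hq : H q.1 q.2 by apply: Hin; rewrite inE mem_rcons mem_head orbT.
  pose L' := (p.1, q.2 * p.2) :: L.
  have prodE : list_prod L' = q.2 * list_prod (p :: rcons L q) * q.2^-1.
    rewrite /L' -cats1 !list_prod_cons list_prod_cat list_prod_cons /=.
    by rewrite /list_prod big_nil mulg1 !mulgA mulgK.
  have [||||i [v [Pv Hv]]] := IHn L'.
  - by move: leLn; rewrite /= size_rcons.
  - move=> c; rewrite inE => /orP[/eqP ->|cL].
      by apply: (bad_merge bqp) => //; apply: Hin; rewrite mem_head.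
    by apply: Hin; rewrite inE mem_rcons inE cL !orbT.
  - rewrite prodE; apply: contraNneq prod1 => E.
    apply/eqP; apply: (mulgI q.2); apply: (mulIg q.2^-1); rewrite E.
    by rewrite mulg1 mulgV.
  - by rewrite prodE !mulgA mulgVK -(mulgA q.2) prodsq mulg1 mulgV.
  exists i, (q.2^-1 * v); split; first by apply: PM => //; apply: PV; exact: HP Hq.
  by move: Hv; rewrite prodE invgM invgK !mulgA.
have red : reduced C (p :: rcons L q ++ p :: rcons L q).
  by apply: not_bad_reduced; rewrite rcons_path pp last_rcons.
have := reduced_neq1 red isT; rewrite -cat_cons list_prod_cat prodsq eqxx => neq1.
suff: false by []; apply: neq1 => c; rewrite mem_cat orbb; exact: Hin.
Qed.
End InternalAmalgam.

(** * Free products *)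

Section FreeProduct.
Variables (G : groupType) (I : eqType).
Implicit Type L : seq (I * G).

Definition fcons (p : I * G) L := if p.2 == 1 then L else p :: L.

(** Left multiplication of a normal form by the element [h] of the factor [i]. All factors live in
    the same [G] and are told apart by their tags. *)
Definition fmul i h L :=
  if L is (j, k) :: L' then
    if i == j then fcons (i, h * k) L' else fcons (i, h) L
  else fcons (i, h) [::].

Lemma fmul_reduced i h L : reduced (pred1 1) L -> reduced (pred1 1) (fmul i h L).
Proof.
case: L => [_|[j k] L]; rewrite /fmul /fcons /reduced /=.
  by case: ifP => //= ->.
move=> /andP[pL /andP[k1 aL]]; have sL := path_sorted pL.
case: eqVneq => [eij|nij] /=; case: ifP => h1 /=; rewrite ?h1 ?k1 ?aL ?pL ?sL ?nij //=.
by move: pL; rewrite eij andbT; case: (L).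
Qed.

Lemma fmul_cons i h L :
  h != 1 -> reduced (pred1 1) ((i, h) :: L) -> fmul i h L = (i, h) :: L.
Proof.
move=> h1; case: L => [_|[j k] L]; rewrite /fmul /fcons /= (negPf h1)//.
by rewrite /reduced /= => /andP[/andP[/negPf ->]].
Qed.

Lemma fmul1 i L : reduced (pred1 1) L -> fmul i 1 L = L.
Proof.
case: L => [_|[j k] L]; rewrite /fmul /fcons /= eqxx//.
by case: eqVneq => [->|//]; rewrite mul1g /reduced /= => /andP[_ /andP[/negPf ->]].
Qed.

(** If [k] cancels the head of [L], reducedness gives the next entry another tag, so [h] is put in
    front of it and not merged. *)
Lemma fmulM i h k L :
  reduced (pred1 1) L -> fmul i h (fmul i k L) = fmul i (h * k) L.
Proof.
case: L => [_|[j k'] L redL]; rewrite /fmul /fcons /=.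
  by case: eqP => [->|_]; rewrite ?eqxx ?mulg1.
case: eqVneq redL => [<-{j}|nij] redL /=; last first.
  case: eqP => [->|_]; first by rewrite (negPf nij) mulg1.
  by rewrite eqxx.
rewrite -mulgA; case: eqP => [->|_]; last by rewrite eqxx.
rewrite mulg1; case: L redL => [//|[j l] L].
by rewrite /reduced /= => /andP[/andP[/negPf -> _] _].
Qed.

End FreeProduct.

(** * Generators with orders and one relator x0^2 w *)

Section OneRelatorProduct.
Variables (G : groupType) (I : eqType) (s : I -> G).
Variables (rels : word I -> Prop) (x0 : I) (wd : seq I) (ord : I -> nat).

Definition positive (t : seq I) : word I := [seq (i, false) | i <- t].

Hypothesis x0_wd : x0 \notin wd.
Hypothesis relsP : forall r, rels r ->
  r = positive [:: x0, x0 & wd] \/ exists2 i, i != x0 & r = nseq (ord i) (i, false).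
Hypothesis rels_surface : rels (positive [:: x0, x0 & wd]).
Hypothesis rels_order : forall i, i != x0 -> s i ^+ ord i = 1.
Hypothesis pres : forall w, eval_word s w = 1 <-> word_eqv rels w [::].

Let w0 := eval_word s (positive wd).

Let sq_x0 : s x0 * s x0 * w0 = 1.
Proof.
have /pres : word_eqv rels (positive [:: x0, x0 & wd]) [::].
  by have := WordRelator [::] [::] rels_surface; rewrite cats0.
by rewrite /= !eval_word_cons mulgA.
Qed.

(** * Orders of generators from weighted exponent sums *)

Section Weight.
Variable f : I -> int.
Local Open Scope ring_scope.

Definition weight (w : word I) : int := \sum_(l <- w) (if l.2 then - f l.1 else f l.1).

Lemma weight_cat u v : weight (u ++ v) = weight u + weight v.
Proof. exact: big_cat. Qed.

Lemma weight_cons l v : weight (l :: v) = (if l.2 then - f l.1 else f l.1) + weight v.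
Proof. exact: big_cons. Qed.

Lemma weight_nseq n i : weight (nseq n (i, false)) = f i *+ n.
Proof.
by elim: n => [|n IHn]; rewrite /weight ?big_nil// big_cons [X in _ + X]IHn mulrS.
Qed.

Lemma weight_positive t : weight (positive t) = \sum_(i <- t) f i.
Proof. by rewrite /weight big_map. Qed.

(** Once every relator has weight divisible by [M], the weight is a homomorphism from the presented
    group to the integers modulo [M]. *)
Lemma dvdz_weight (M : int) u v :
  (M %| f x0 + f x0 + \sum_(i <- wd) f i)%Z ->
  (forall i, i != x0 -> M %| f i *+ ord i)%Z ->
  word_eqv rels u v -> (M %| weight u - weight v)%Z.
Proof.
move=> Msurf Mord; elim=> {u v} [u|u v _|u v w _ IHu _ IHv|u v i e|u v r /relsP rr].
- by rewrite subrr dvdz0.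
- by rewrite -opprB rpredN.
- by rewrite -(subrKA (weight v)) rpredD.
- rewrite !weight_cat !weight_cons /=.
  have -> : weight u + ((if e then - f i else f i) + ((if ~~ e then - f i else f i)
    + weight v)) - (weight u + weight v) = 0 by case: e => /=; ring.
  exact: dvdz0.
- rewrite !weight_cat.
  have -> : weight u + (weight r + weight v) - (weight u + weight v) = weight r by ring.
  case: rr => [->|[i ix0 ->]]; last by rewrite weight_nseq Mord.
  by rewrite weight_positive !big_cons addrA.
Qed.

End Weight.

(* [i] has weight 2, and the weight of [x0] makes the surface relator vanish. *)
Definition order_weight (i j : I) : int :=
  (if j == i then 2 else if j == x0 then - (count_mem i wd)%:Z else 0)%R.

(** In the surface relator the two letters [x0] cancel the weight 2 of each [i] in [wd]. Giving [i]
    weight 2 keeps the weight of [x0] integral, whence the modulus [2 * ord i]. *)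
Lemma dvdz_order_weight i w : i != x0 -> eval_word s w = 1 ->
  ((ord i).*2 %| weight (order_weight i) w)%Z.
Proof.
move=> ix0 /pres /(@dvdz_weight (order_weight i) (ord i).*2).
rewrite /weight big_nil subr0; apply.
  have sumE (c : int) t : x0 \notin t ->
    (\sum_(j <- t) (if j == i then 2 else if j == x0 then c else 0) = (count_mem i t)%:Z *+ 2)%R.
    elim: t => [|j t IHt] /=; first by rewrite big_nil.
    rewrite inE negb_or => /andP[/negPf x0j /IHt IH]; rewrite big_cons IH.
    by rewrite [j == x0]eq_sym x0j !mulr2n; case: eqP => _; lia.
  rewrite sumE// mulr2n /order_weight eqxx eq_sym (negPf ix0) -opprD addNr.
  exact: dvdz0.
move=> j jx0; rewrite /order_weight.
case: eqP => [->|_]; last by rewrite (negPf jx0) mul0rn dvdz0.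
have -> : (2 *+ ord i = ((ord i).*2)%:Z :> int)%R by rewrite -mulr_natr natz; lia.
exact: dvdzz.
Qed.

Lemma dvdn_order i n : i != x0 -> s i ^+ n = 1 -> (ord i %| n)%N.
Proof.
move=> ix0 sn; have := @dvdz_order_weight i (nseq n (i, false)) ix0.
rewrite eval_word_nseq weight_nseq /order_weight eqxx => /(_ sn).
have -> : (2 *+ n = (n.*2)%:Z :> int)%R by rewrite -mulr_natr natz; lia.
by rewrite dvdzE /= -!muln2 dvdn_pmul2r.
Qed.

(** For [ord i = 0] the weight [- n * count_mem i wd] of the word [x0^n] would have to vanish,
    though [i] occurs in [wd]. *)
Lemma x0_order_gt0 i n : i \in wd -> 0 < n -> s x0 ^+ n = 1 -> 0 < ord i.
Proof.
move=> iwd n0 sn; have ix0 : i != x0 by apply: contraNneq x0_wd => <-.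
have := @dvdz_order_weight i (nseq n (x0, false)) ix0.
rewrite eval_word_nseq weight_nseq /order_weight eqxx eq_sym (negPf ix0) => /(_ sn).
case: (ord i) => //; rewrite dvd0z mulrn_eq0 oppr_eq0 (gtn_eqF n0) /=.
by move: iwd; rewrite -has_pred1 has_count; case: count.
Qed.

(** * The free product of the cyclic groups of the generators other than [x0] *)

Section FreeAction.
Let S : Type := (seq (I * G) * bool)%type.

Let wl (t : seq I) L := foldr (fun i => fmul i (s i)) L t.
Let wlV (t : seq I) L := foldl (fun L i => fmul i (s i)^-1 L) L t.

Let wl_red t L : reduced (pred1 1) L -> reduced (pred1 1) (wl t L).
Proof. by move=> rL; elim: t => //= i t; exact: fmul_reduced. Qed.

Let wlV_red t L : reduced (pred1 1) L -> reduced (pred1 1) (wlV t L).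
Proof. by elim: t L => //= i t IHt L rL; apply/IHt/fmul_reduced. Qed.

Let wlK t L : reduced (pred1 1) L -> wlV t (wl t L) = L.
Proof.
elim: t L => //= i t IHt L rL.
by rewrite fmulM ?mulVg ?fmul1 ?IHt//; exact: wl_red.
Qed.

Let wlVK t L : reduced (pred1 1) L -> wl t (wlV t L) = L.
Proof.
elim: t L => //= i t IHt L rL.
by rewrite IHt ?fmulM ?mulgV ?fmul1//; exact: fmul_reduced.
Qed.

(* The square of [x0] is the inverse of [wd] on both copies of the free
   product, so the second copy makes room for a square root. *)
Let act (l : I * bool) (x : S) : S :=
  let: (i, e) := l in let: (L, b) := x in
  if i == x0 then
    if e then (if b then (L, false) else (wl wd L, true))
    else (if b then (wlV wd L, false) else (L, true))
  else (fmul i (if e then (s i)^-1 else s i) L, b).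

Let V (x : S) : Prop := reduced (pred1 1) x.1.

Let act_closed l x : V x -> V (act l x).
Proof.
case: l x => [i e] [L b]; rewrite /V /= => rL.
case: ifP => _; last exact: fmul_reduced.
by case: e; case: b => //=; [exact: wl_red | exact: wlV_red].
Qed.

Let actK i e x : V x -> act (i, e) (act (i, ~~ e) x) = x.
Proof.
case: x => L b; rewrite /V /= => rL; case: (i == x0) => /=.
  by case: e; case: b => //=; rewrite ?wlK ?wlVK.
by rewrite fmulM//; case: e; rewrite /= ?mulgV ?mulVg fmul1.
Qed.

Let act_positive t L b : x0 \notin t -> act_word act (positive t) (L, b) = (wl t L, b).
Proof.
elim: t => //= i t IHt; rewrite inE negb_or => /andP[x0i x0t] /=.
by rewrite IHt//= eq_sym (negPf x0i).
Qed.

Let act_nseq n i e L b : i != x0 -> reduced (pred1 1) L ->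
  act_word act (nseq n (i, e)) (L, b) = (fmul i ((if e then (s i)^-1 else s i) ^+ n) L, b).
Proof.
move=> /negPf ix0 rL; elim: n => [|n IHn] /=; first by rewrite expg0 fmul1.
by rewrite IHn ix0 fmulM// expgS.
Qed.

Let act_rels r x : rels r -> V x -> act_word act r x = x.
Proof.
case: x => L b /relsP[->|[i ix0 ->]] rL; last first.
  by rewrite act_nseq// rels_order// fmul1.
rewrite /= act_positive//; move: rL; rewrite /V /= => rL.
by case: b; rewrite /= !eqxx /= wlK.
Qed.

(** A word spelling the product of [L] takes the empty normal form to [L]; if the product were 1,
    that word would act trivially. *)
Lemma free_product_reduced L :
  reduced (pred1 1) L -> L != [::] ->
  (forall p, p \in L -> p.1 != x0 /\ powers (s p.1) p.2) -> list_prod L != 1.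
Proof.
move=> rL L0 Lin.
have [W [eW aW]] : exists W, eval_word s W = list_prod L /\
    act_word act W ([::], false) = (L, false).
  elim: L {L0} rL Lin => [_ _|[i h] L IHL rL Lin].
    by exists [::]; rewrite eval_word_nil /list_prod big_nil.
  have rL' : reduced (pred1 1) L.
    by move: rL; rewrite /reduced /= => /andP[/path_sorted -> /andP[]].
  have [|W [eW aW]] := IHL rL'; first by move=> p pL; apply: Lin; rewrite inE pL orbT.
  have [/= ix0 [m [n hE]]] := Lin (i, h) (mem_head _ _).
  exists (nseq m (i, false) ++ nseq n (i, true) ++ W); split.
    rewrite !eval_word_cat !eval_word_nseq eW list_prod_cons mulgA /=.
    by rewrite expVgn -hE.
  rewrite !act_word_cat aW !act_nseq//; last exact: fmul_reduced.
  rewrite fmulM// expVgn -hE fmul_cons//.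
  by move: rL; rewrite /reduced /= => /andP[_ /andP[]].
apply: contraNneq L0 => L1; rewrite L1 in eW.
have /(act_word_eqv act_closed actK act_rels) := (pres W).1 eW.
by move=> /(_ ([::], false) isT); rewrite aW => -[->].
Qed.

End FreeAction.

(** Since [w0 = x0^-2], torsion of [x0] would give torsion of [w0]. But [n] copies of [wd] form a
    reduced list: the letters are nontrivial, and cyclic neighbours differ as there are at least two
    distinct letters. *)
Lemma x0_infinite (n : nat) : uniq wd -> (1 < size wd)%N ->
  {in wd, forall i, ord i != 1%N} -> 0 < n -> s x0 ^+ n <> 1.
Proof.
move=> uwd swd ord1 n0 sn.
pose E := [seq (i, s i) | i <- wd].
have prodE t : list_prod [seq (i, s i) | i <- t] = eval_word s (positive t).
  by rewrite /list_prod /eval_word !big_map.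
have prodn k : list_prod (flatten (nseq k E)) = w0 ^+ k.
  elim: k => [|k IHk]; first by rewrite /list_prod big_nil.
  by rewrite /= list_prod_cat IHk prodE expgS.
have Ein p k : p \in flatten (nseq k E) -> p.1 \in wd /\ p.2 = s p.1.
  by move=> /flattenP[t /nseqP[-> _] /mapP[i iwd ->]].
suff /free_product_reduced : reduced (pred1 1) (flatten (nseq n E)).
  move=> neq1; have : list_prod (flatten (nseq n E)) != 1.
    apply: neq1 => [|p /Ein[pwd ->]]; first by move: n0 swd; rewrite /E; case: (n) => //; case: (wd).
    split; last exact: powers_id.
    by apply: contraNneq x0_wd => <-.
  have w0E : w0 = (s x0 * s x0)^-1 by rewrite (mulg1_eq sq_x0).
  by rewrite prodn w0E -expg2 expVgn -expgnA mulnC expgnA sn expg1n invg1 eqxx.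
apply/andP; split; last first.
  apply/allP => p /Ein[pwd ->] /=.
  have px0 : p.1 != x0 by apply: contraNneq x0_wd => <-.
  apply: contraNneq (ord1 _ pwd) => s1.
  by rewrite -dvdn1 (@dvdn_order _ 1)// expg1.
have cE : cycle (fun p q : I * G => p.1 != q.1) E.
  move: uwd swd; rewrite /E; case: (wd) => [//|i t] /= /andP[it ut] st.
  rewrite rcons_path; apply/andP; split.
    suff : path (fun j k => j != k) i t by rewrite path_map.
    have : sorted (fun j k : I => j != k) (i :: t).
      by apply: pairwise_sorted; rewrite -uniq_pairwise /= it ut.
    by [].
  rewrite last_map /=; case: t it ut st => [//|j t] it _ _ /=.
  by apply: contraNneq it => <-; rewrite mem_last.
case: (E) cE => [|p t] /= pt; first by elim: (n).
have : path (fun p q => p.1 != q.1) (last p t) (flatten (nseq n (p :: t))).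
  move: pt; rewrite rcons_path => /andP[pt lp].
  elim: (n) => [//|k IHk] /=; rewrite lp /= cat_path pt.
  exact: IHk.
exact: path_sorted.
Qed.

(** * The amalgam of the two factors over the cyclic group generated by [w0] *)

Let C : pred G := fun h => `[< powers w0 h >].

Let C1 : C 1. Proof. exact/asboolP/powers1. Qed.
Let Cw0 : C w0. Proof. exact/asboolP/powers_id. Qed.

Let CM h k : C h -> C k -> C (h * k).
Proof. by move=> /asboolP ? /asboolP ?; apply/asboolP/powersM. Qed.

Let CV h : C h -> C h^-1.
Proof. by move=> /asboolP ?; apply/asboolP/powersV. Qed.

Let CMl h k : C h -> C (h * k) = C k.
Proof.
move=> Ch; apply/idP/idP => [Chk|]; last exact: CM.
by rewrite -(mulKg h k); exact: CM (CV Ch) Chk.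
Qed.

Let CMr h k : C k -> C (h * k) = C h.
Proof.
move=> Ck; apply/idP/idP => [Chk|Ch]; last exact: CM.
by rewrite -(mulgK k h); exact: CM Chk (CV Ck).
Qed.

(** A representative of the coset [C k], equal to 1 on [C]. The set passed to [xget] depends on the
    coset only and contains [k], so the default is never returned. *)
Let tau k : G := if C k then 1 else xget 1 [set k' | C (k' / k)]%classic.

Let tau_coset k : C (tau k / k).
Proof.
rewrite /tau; case: ifP => Ck; first by rewrite mul1g CV.
by case: xgetP => [//|/(_ k)]; case; rewrite /= mulgV.
Qed.

Let tau_div k : C (k / tau k).
Proof. by rewrite -invgF CV. Qed.

Let tauM c k : C c -> tau (c * k) = tau k.
Proof.
move=> Cc; rewrite /tau CMl//; case: ifP => // _; congr xget.
by apply/funext => k'; rewrite /= invgM mulgA CMr ?CV.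
Qed.

Let tau1 : tau 1 = 1.
Proof. by rewrite /tau C1. Qed.

Let tau_eq1 k : (tau k == 1) = C k.
Proof.
apply/eqP/idP => [t1|Ck]; last by rewrite /tau Ck.
by have := tau_div k; rewrite t1 divg1.
Qed.

Let tauK k : tau (tau k) = tau k.
Proof. by rewrite -[X in tau X = _](mulgVK k) tauM ?tau_coset. Qed.

Let S : Type := (G * seq G)%type.

(** Only the last representative may be 1: elsewhere [x0 * 1 * x0 = w0^-1] would be absorbed to its
    left. *)
Let Fixpoint valid (l : seq G) : bool :=
  if l is t :: l' then [&& tau t == t, (l' == [::]) || (t != 1) & valid l'] else true.
(** Left multiplication by [x0]. An element [k] of [C] commutes with [x0], so
    [x0 k x0 t = w0^-1 k t]; otherwise the part [k / tau k] in [C] is moved across [x0]. *)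
Let X (y : S) : S :=
  let: (k, l) := y in
  if C k then (if l is t :: l' then (w0^-1 * k * t, l') else (k, [:: 1]))
  else (k / tau k, tau k :: l).

Let X_valid y : valid y.2 -> valid (X y).2.
Proof.
case: y => k [|t l] /=; case: ifP => Ck //=; first by rewrite tau1 eqxx.
- by rewrite tauK eqxx.
- by move=> /and3P[].
- by move=> ->; rewrite tauK eqxx tau_eq1 Ck.
Qed.

Let XX k l : valid l -> X (X (k, l)) = (w0^-1 * k, l).
Proof.
rewrite /X; have [Ck|nCk] := boolP (C k); last first.
  by rewrite tau_div -mulgA mulgVK.
case: l => [_|t l /= /and3P[/eqP tt tl _]]; first by rewrite Ck mulg1.
have CV0k : C (w0^-1 * k) by rewrite CM ?CV.
rewrite CMl// -tau_eq1 tauM// tt mulgK.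
(* If [t = 1], validity makes it the last entry, and the second [X] restores the list [[:: 1]]. *)
case: (t =P 1) tl => [->|_ _] //=; by rewrite orbF => /eqP ->; rewrite mulg1.
Qed.

Let XM k l : X (w0 * k, l) = (w0 * (X (k, l)).1, (X (k, l)).2).
Proof.
rewrite /X CMl//; case: ifP => _; last by rewrite tauM// mulgA.
by case: l => [|t l] //=; rewrite mulKg !mulgA mulgV mul1g.
Qed.

(* Van der Waerden's action on normal forms: [(k, [:: t1; ..; tn])] stands for
   [k * s x0 * t1 * .. * s x0 * tn]. *)
Let act (l : I * bool) (y : S) : S :=
  let: (i, e) := l in
  if i == x0 then (if e then (w0 * (X y).1, (X y).2) else X y)
  else ((if e then (s i)^-1 else s i) * y.1, y.2).

Let V (y : S) : Prop := valid y.2.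

Let act_closed l y : V y -> V (act l y).
Proof.
case: l => i e; rewrite /V /= => Vy.
by case: ifP => // _; case: e => /=; exact: X_valid.
Qed.

Let actK i e y : V y -> act (i, e) (act (i, ~~ e) y) = y.
Proof.
case: y => k l Vl; rewrite /act; case: (i == x0); last first.
  by case: e; rewrite /= ?mulKg ?mulVKg.
have XXE := XX k Vl; case: e; rewrite [~~ _]/=; first by rewrite XXE mulVKg.
by case: (X (k, l)) XXE => k' l' XXE; rewrite XM XXE mulVKg.
Qed.

Let act_word_neq v k l : all (fun j => j.1 != x0) v ->
  act_word act v (k, l) = (eval_word s v * k, l).
Proof.
elim: v => [_|[i e] v IHv] /=; first by rewrite eval_word_nil mul1g.
by move=> /andP[/negPf ix0 /IHv ->]; rewrite ix0 eval_word_cons mulgA.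
Qed.

Let positive_neq t : x0 \notin t -> all (fun j => j.1 != x0) (positive t).
Proof.
move=> x0t; apply/allP => _ /mapP[i it ->] /=.
by apply: contraNneq x0t => <-.
Qed.

Let act_rels r y : rels r -> V y -> act_word act r y = y.
Proof.
case: y => k l /relsP[->|[i ix0 ->]] Vl; last first.
  rewrite act_word_neq; last by rewrite all_nseq ix0 orbT.
  by rewrite eval_word_nseq rels_order// mul1g.
by rewrite /= act_word_neq ?positive_neq// eqxx XX// -/w0 mulKg.
Qed.

Definition vertex_group (h : G) : Prop :=
  exists2 v, all (fun j => j.1 != x0) v & eval_word s v = h.

Definition amalgam_factor (b : bool) (h : G) : Prop :=
  if b then vertex_group h else powers (s x0) h.

Let vertex_groupM h k : vertex_group h -> vertex_group k -> vertex_group (h * k).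
Proof.
move=> [u uP <-] [v vP <-]; exists (u ++ v); last exact: eval_word_cat.
by rewrite all_cat uP.
Qed.

Let vertex_groupV h : vertex_group h -> vertex_group h^-1.
Proof.
move=> [u uP <-]; exists (inv_word u); last exact: eval_inv_word.
by rewrite all_rev all_map.
Qed.

Let C_vertex c : C c -> vertex_group c.
Proof.
have w0n n : vertex_group (w0 ^+ n).
  elim: n => [|n IHn]; first by exists [::]; rewrite ?eval_word_nil.
  by rewrite expgS; apply: vertex_groupM => //; exists (positive wd) => //; exact: positive_neq.
by move=> /asboolP[m [n ->]]; apply: vertex_groupM => //; exact: vertex_groupV.
Qed.

Let w0E : w0 = (s x0 ^+ 2)^-1.
Proof. by rewrite expg2 (mulg1_eq sq_x0). Qed.

Let C_powers c : C c -> powers (s x0) c.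
Proof.
have w0n n : powers (s x0) (w0 ^+ n).
  by rewrite w0E expVgn -expgnA; apply: powersV; exact: powers_expg.
by move=> /asboolP[m [n ->]]; apply: powersM => //; exact: powersV.
Qed.

(** Even powers of [x0] are powers of [w0], so only odd powers are left. *)
Let powers_notC h : powers (s x0) h -> ~~ C h -> exists2 c, C c & h = s x0 * c.
Proof.
have sqn n : C (s x0 ^+ n.*2).
  rewrite -mul2n expgnA -[s x0 ^+ 2]invgK -w0E expVgn.
  exact/CV/asboolP/powers_expg.
move=> [m [n ->]] nC.
(* The denominator becomes even, so the parity of [m + n] decides. *)
have E : s x0 ^+ m / s x0 ^+ n = s x0 ^+ (m + n) / s x0 ^+ n.*2.
  by rewrite -addnn !expgnDr invgM mulgA mulgK.
rewrite E -(odd_double_half (m + n)) expgnDr in nC *.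
case: (odd _) nC => /=; last by rewrite expg0 mul1g CM ?CV.
by exists (s x0 ^+ (m + n)./2.*2 / s x0 ^+ n.*2); rewrite ?CM ?CV// expg1 mulgA.
Qed.

(** A word [W] spelling the product is applied to [(1, [::])]. After a factor of the vertex group
    the head lies outside [C]; after one of [x0], spelled [x0 c] with [c] in [C], the head lies in
    [C] but the list is nonempty. Either way [(1, [::])] is not fixed. *)
Lemma amalgam_reduced (L : seq (bool * G)) :
  reduced C L -> L != [::] -> (forall p, p \in L -> amalgam_factor p.1 p.2) ->
  list_prod L != 1.
Proof.
move=> rL L0 Lin.
have [W [eW Vy yP]] : exists W, [/\ eval_word s W = list_prod L,
    V (act_word act W (1, [::])) &
    let y := act_word act W (1, [::]) in
    if L is (b, _) :: _ then if b then ~~ C y.1 else C y.1 && (y.2 != [::])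
    else y = (1, [::])].
  elim: L {L0} rL Lin => [_ _|[b h] L IHL rL Lin].
    by exists [::]; rewrite eval_word_nil /list_prod big_nil.
  have /andP[/= pL /andP[nCh aL]] := rL.
  have rL' : reduced C L by rewrite /reduced (path_sorted pL).
  have [|W [eW]] := IHL rL'; first by move=> p pL'; apply: Lin; rewrite inE pL' orbT.
  case yE: (act_word act W (1, [::])) => [k l]; rewrite {1}/V /= => Vl yP.
  have := Lin (b, h) (mem_head _ _); case: b {rL Lin} pL => /= pL Hh.
    have Ck : C k.
      by case: L yP pL {IHL aL rL' eW} => [[-> _]//|[[] h'] L] //= /andP[].
    have [v vP vh] := Hh; exists (v ++ W).
    rewrite eval_word_cat vh eW list_prod_cons act_word_cat yE act_word_neq// vh.
    by split=> //=; rewrite CMr.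
  have [c Cc hE] := powers_notC Hh nCh.
  have [v vP vc] := C_vertex Cc; exists ((x0, false) :: v ++ W).
  rewrite eval_word_cons eval_word_cat vc eW list_prod_cons /= mulgA -hE.
  rewrite act_word_cat yE act_word_neq// vc eqxx.
  split=> //; first exact: (@X_valid (c * k, l)).
  rewrite /X CMl//; case: L yP pL {IHL aL rL' eW} => [[-> ->]|[[] h'] L] //=.
    by rewrite C1 mulg1 Cc.
  by move=> /negPf nCk _; rewrite nCk /= tau_div.
apply: contraNneq L0 => L1; rewrite L1 in eW.
have /(act_word_eqv act_closed actK act_rels) := (pres W).1 eW.
move=> /(_ (1, [::]) isT) /= yE; move: yP; rewrite yE /=.
by case: L {rL Lin L1} => [//|[[] h] L]; rewrite ?C1 ?andbF.
Qed.

(** * Conjugating involutions into cyclic groups *)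

Let span (v : G) : Prop := exists w, v = eval_word s w.

Let span1 : span 1. Proof. by exists [::]; rewrite eval_word_nil. Qed.

Let spanM h k : span h -> span k -> span (h * k).
Proof. by move=> [u ->] [v ->]; exists (u ++ v); rewrite eval_word_cat. Qed.

Let spanV h : span h -> span h^-1.
Proof. by move=> [u ->]; exists (inv_word u); rewrite eval_inv_word. Qed.

Let span_powers i h : powers (s i) h -> span h.
Proof.
have spann n : span (s i ^+ n) by exists (nseq n (i, false)); rewrite eval_word_nseq.
by move=> [m [n ->]]; apply: spanM => //; exact: spanV.
Qed.

Let letter (l : I * bool) : G := if l.2 then (s l.1)^-1 else s l.1.

Let letter_powers l : powers (s l.1) (letter l).
Proof. by rewrite /letter; case: l.2; [apply: powersV|]; exact: powers_id. Qed.

Lemma involution_amalgam_factor w :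
  let u := eval_word s w in u != 1 -> u * u = 1 ->
  exists b v, span v /\ amalgam_factor b (v^-1 * u * v).
Proof.
pose L := [seq (l.1 != x0, letter l) | l <- w].
have -> : eval_word s w = list_prod L by rewrite /list_prod /eval_word big_map.
move=> u u1 uu; apply: (@involution_conj_factor _ _ amalgam_factor C span) u1 uu.
- by case=> /= h k; [exact: vertex_groupM | exact: powersM].
- case=> /= c h Cc Hh; last exact: powersM (C_powers Cc) Hh.
  exact: vertex_groupM (C_vertex Cc) Hh.
- exact: span1.
- exact: spanV.
- exact: spanM.
- by case=> /= h; [case=> v _ <-; exists v | exact: span_powers].
- exact: amalgam_reduced.
move=> _ /mapP[l _ ->] /=; case: eqVneq => [lx0|lx0] /=.
  by rewrite -lx0; exact: letter_powers.
exists [:: l]; rewrite ?eval_word_cons ?eval_word_nil ?mulg1 //=.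
by rewrite lx0.
Qed.

(** The same reduction inside the vertex group, now with trivial amalgamated subgroup. *)
Lemma involution_free_factor h : vertex_group h -> h != 1 -> h * h = 1 ->
  exists i v, span v /\ (i != x0 /\ powers (s i) (v^-1 * h * v)).
Proof.
move=> [w wx0 <-]; pose L := [seq (l.1, letter l) | l <- w].
have -> : eval_word s w = list_prod L by rewrite /list_prod /eval_word big_map.
move=> u1 uu.
apply: (@involution_conj_factor _ _ (fun i h => i != x0 /\ powers (s i) h) (pred1 1) span) u1 uu.
- by move=> i k l [? Hk] [? Hl]; split=> //; exact: powersM.
- by move=> i c k /eqP ->; rewrite mul1g.
- exact: span1.
- exact: spanV.
- exact: spanM.
- by move=> i k [_ /span_powers].
- exact: free_product_reduced.
by move=> _ /mapP[l lw ->] /=; split; [exact: (allP wx0) | exact: letter_powers].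
Qed.

Lemma involution_conj_generator w :
  let u := eval_word s w in u != 1 -> u * u = 1 ->
  (forall n, 0 < n -> s x0 ^+ n <> 1) ->
  exists i v, [/\ i != x0, 0 < ord i, ~~ odd (ord i) &
    u = eval_word s v * s i ^+ (ord i)./2 * (eval_word s v)^-1].
Proof.
move=> u u1 uu x0_inf.
have conj1 (v k : G) : k != 1 -> v^-1 * k * v != 1.
  apply: contraNneq => E; have -> : k = v * (v^-1 * k * v) / v.
    by rewrite !mulgA mulgV mul1g mulgK.
  by rewrite E mulg1 mulgV.
have conj2 (v k : G) : k * k = 1 -> (v^-1 * k * v) * (v^-1 * k * v) = 1.
  by move=> kk; rewrite !mulgA mulgK -(mulgA _ k k) kk mulg1 mulVg.
have [b [v1 [[w1 v1E] Hb]]] := involution_amalgam_factor u1 uu.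
have h1 := conj1 v1 _ u1; have hh := conj2 v1 _ uu.
set h := v1^-1 * u * v1 in h1 hh Hb.
case: b Hb => /= Hh; last first.
  have [n n0] := powers_torsion Hh h1 (isT : (0 < 2)%N) hh.
  by move/(x0_inf n n0).
have [i [v2 [[w2 v2E] [ix0 Hk]]]] := involution_free_factor Hh h1 hh.
have k1 := conj1 v2 _ h1; have kk := conj2 v2 _ hh.
set k := v2^-1 * h * v2 in k1 kk Hk.
have [n n0 sn] := powers_torsion Hk k1 (isT : (0 < 2)%N) kk.
have [m kE] := powers_finite n0 sn Hk.
have o0 : 0 < ord i by apply: dvdn_gt0 n0 (dvdn_order ix0 sn).
have d2m : (ord i %| m.*2)%N.
  by apply: dvdn_order => //; rewrite -addnn expgnDr -kE.
have ndm : ~~ (ord i %| m)%N.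
  apply: contra k1 => /dvdnP[q mE]; rewrite kE mE mulnC expgnA.
  by rewrite rels_order// expg1n.
have /dvdnP[q mq] := d2m.
(* Here [2 m = q * ord i]. An even [q] would make [ord i] divide [m], so [q] is odd, and then
   [ord i] is even. *)
have oq : odd q.
  apply: contraNT ndm => /negbTE oq; apply/dvdnP; exists q./2.
  have := odd_double_half q; rewrite oq add0n.
  by move: mq; set a := q./2; nia.
have eo : ~~ odd (ord i).
  by have := congr1 odd mq; rewrite odd_double oddM oq /= => <-.
have mE : m = (ord i * q./2 + (ord i)./2)%N.
  have := odd_double_half q; have := odd_double_half (ord i); rewrite oq (negPf eo) /=.
  by move: mq; set a := q./2; set o := (ord i)./2 => mq oE qE; nia.
exists i, (w1 ++ w2); split=> //.
have -> : s i ^+ (ord i)./2 = k.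
  by rewrite kE mE expgnDr expgnA rels_order// expg1n mul1g.
rewrite eval_word_cat -v1E -v2E /k /h invgM !mulgA.
by rewrite !mulgK mulgV mul1g.
Qed.

(** A single letter of [wd] equals [w0 = x0^-2], so [x0] generates the whole group. *)
Lemma finite_of_x0 (n : nat) w : (size wd <= 1)%N -> (forall i, i = x0 \/ i \in wd) ->
  s x0 ^+ n = 1 -> eval_word s w ^+ n = 1.
Proof.
move=> swd all_gen sn; apply: (powers_expg_eq1 sn).
have gen i : powers (s x0) (s i).
  have [->|iwd] := all_gen i; first exact: powers_id.
  have -> : s i = w0; last exact: C_powers.
  rewrite /w0; case: (wd) swd iwd => [//|j [|//]] _; rewrite inE => /eqP ->.
  by rewrite eval_word_cons eval_word_nil mulg1.
elim: w => [|[i e] w IHw]; first by rewrite eval_word_nil; exact: powers1.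
rewrite eval_word_cons; apply: powersM IHw.
by case: e => //=; exact: powersV.
Qed.

End OneRelatorProduct.

(** * Orbifold groups *)

Section OrbifoldGen.
Variables g r b : nat.

Definition sum_of_orbifold_gen (z : orbifold_gen g r b) : 'I_g + 'I_r + 'I_b :=
  match z with Crosscap i => inl (inl i) | Cone i => inl (inr i) | Boundary i => inr i end.

Definition orbifold_gen_of_sum (z : 'I_g + 'I_r + 'I_b) : orbifold_gen g r b :=
  match z with inl (inl i) => Crosscap i | inl (inr i) => Cone i | inr i => Boundary i end.

Lemma sum_of_orbifold_genK : cancel sum_of_orbifold_gen orbifold_gen_of_sum.
Proof. by case. Qed.

HB.instance Definition _ := Equality.copy (orbifold_gen g r b) (can_type sum_of_orbifold_genK).

End OrbifoldGen.

(** The surface word without the square of its first crosscap. *)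
Definition surface_tail (g r b : nat) : seq (orbifold_gen g.+1 r b) :=
  flatten [seq [:: Crosscap (lift ord0 i); Crosscap (lift ord0 i)] | i <- enum 'I_g]
  ++ [seq Cone i | i <- enum 'I_r] ++ [seq Boundary i | i <- enum 'I_b].

Lemma surface_wordE g r b :
  surface_word g.+1 r b = positive [:: Crosscap ord0, Crosscap ord0 & surface_tail g r b].
Proof.
rewrite /surface_word enum_ordSl /= /positive !map_cat map_flatten -!map_comp.
by congr [:: _, _ & _ ++ _].
Qed.

Lemma mem_surface_tail g r b (z : orbifold_gen g.+1 r b) :
  (z \in surface_tail g r b) = (z != Crosscap ord0).
Proof.
rewrite /surface_tail !mem_cat; case: z => [i|i|i].
- have [-> | [j ->]] : i = ord0 \/ exists j, i = lift ord0 j.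
    by case: (unliftP ord0 i) => [j ->|->]; [right; exists j | left].
  + rewrite eqxx; apply/negbTE/negP => /or3P[/flattenP[t /mapP[j _ ->]]|/mapP[]|/mapP[]]//.
  + have -> : Crosscap (lift ord0 j) != Crosscap ord0 :> orbifold_gen g.+1 r b.
      by apply/eqP => -[].
    apply/orP; left; apply/flattenP.
    exists [:: Crosscap (lift ord0 j); Crosscap (lift ord0 j)]; last exact: mem_head.
    by apply: map_f; rewrite mem_enum.
- by rewrite (map_f _ (mem_enum _ _)) orbT; apply/esym/eqP.
- by rewrite (map_f _ (mem_enum _ _)) !orbT; apply/esym/eqP.
Qed.

(** The value 0 stands for infinite order: [s z ^+ 0 = 1] says nothing, and divisibility by 0 forces
    an exponent to vanish. *)
Definition gen_order g r b (mu : 'I_r -> nat) (z : orbifold_gen g r b) : nat :=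
  if z is Cone i then mu i else 0.

Lemma eval_word_in (G : groupType) (H : groupClosed G) (I : Type) (s : I -> G) w :
  (forall i, s i \in H) -> eval_word s w \in H.
Proof.
move=> sH; elim: w => [|[i e] w IHw]; first by rewrite eval_word_nil gpred1.
by rewrite eval_word_cons gpredM//; case: e; rewrite /= ?gpredV.
Qed.

Theorem theorem2p6 (R : realType) (Gamma : groupClosed (PGL R 2))
    (g r b : nat) (mu : 'I_r -> nat)
    (x : 'I_g -> PGL R 2) (c : 'I_r -> PGL R 2) (d : 'I_b -> PGL R 2)
    (hGamma : nonorientable_orbifold_group Gamma mu x c d)
    (not_RP2 : ~ (g = 1 /\ r = 0 /\ b = 0)%N)
    (not_Klein : ~ (g = 2 /\ r = 0 /\ b = 0)%N)
    (a : PGL R 2) (a_Gamma : a \in Gamma)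
    (a_inf : infinite_order a) (a_rev : reversible_in Gamma a) :
  exists (i j : 'I_r) (h k : PGL R 2),
    [/\ ~~ odd (mu i), ~~ odd (mu j), h \in Gamma, k \in Gamma
      & a = h * (c i ^+ (mu i)./2 * k * c j ^+ (mu j)./2 * k^-1) * h^-1]%g.
Proof.
clear not_RP2 not_Klein; case: hGamma => _; case: g x => // g x _ mu_gt1 [s_in words pres].
set s := orbifold_gen_val x c d in s_in words pres.
pose x0 : orbifold_gen g.+1 r b := Crosscap ord0; pose wd := surface_tail g r b.
have x0_wd : x0 \notin wd by rewrite mem_surface_tail eqxx.
have relsP rl : orbifold_relator mu rl -> rl = positive [:: x0, x0 & wd] \/
    exists2 i, i != x0 & rl = nseq (gen_order mu i) (i, false).
  by case=> [i|]; [right; exists (Cone i) => //; apply/eqP | left; exact: surface_wordE].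
have rels_surface : orbifold_relator mu (positive [:: x0, x0 & wd]).
  by rewrite -surface_wordE; exact: SurfaceRelator.
have rels_order i : i != x0 -> s i ^+ gen_order mu i = 1.
  case: i => //= i _; have := @eval_word_nseq _ _ s (mu i) (Cone i) false.
  move=> /= <-; apply/pres; rewrite -[X in word_eqv _ X]cats0.
  exact: (@WordRelator _ _ [::] [::]) (ConeRelator _ _ _ _).
have x0_inf n : (0 < n)%N -> s x0 ^+ n <> 1.
  move=> n0 sn; have [w aE] := words a a_Gamma.
  (* If [x0] has finite order, exponent sums leave only cone generators besides it. Two or more of
     them contradict [x0_infinite]; with at most one, [Gamma] is finite cyclic and [a] has finite
     order. *)
  have cone z : z != x0 -> exists i, z = Cone i.
    move=> zx0; have zwd : z \in wd by rewrite mem_surface_tail.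
    have := x0_order_gt0 x0_wd relsP pres zwd n0 sn.
    by case: z {zx0 zwd} => // i _; exists i.
  apply: (a_inf n n0); rewrite aE.
  apply: (finite_of_x0 rels_surface pres) => // [|i]; last first.
    by rewrite mem_surface_tail; case: eqVneq; [left | right].
  rewrite leqNgt; apply/negP => swd.
  apply: (x0_infinite x0_wd relsP rels_surface rels_order pres _ swd _ n0 sn).
    have gE : enum 'I_g = [::].
      case: (enum 'I_g) => // i t.
      by have [|k //] := cone (Crosscap (lift ord0 i)); apply/eqP => -[].
    have bE : enum 'I_b = [::].
      by case: (enum 'I_b) => // i t; have [|k //] := cone (Boundary i); apply/eqP.
    by rewrite /wd /surface_tail gE bE cats0 map_inj_uniq ?enum_uniq// => i j [].
  move=> i; rewrite mem_surface_tail => /cone[j ->] /=.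
  by rewrite gtn_eqF.
have involution u : u \in Gamma -> u != 1 -> u * u = 1 ->
    exists i v, [/\ ~~ odd (mu i), v \in Gamma & u = v * c i ^+ (mu i)./2 * v^-1].
  move=> /words[w ->] u1 uu.
  have [i [v [ix0 o0 eo uE]]] := involution_conj_generator x0_wd relsP rels_surface
    rels_order pres u1 uu x0_inf.
  case: i ix0 o0 eo uE => // i _ _ ei uE; exists i, (eval_word s v); split=> //.
  exact: eval_word_in.
have a2 : a * a <> 1 by rewrite -expg2; exact: a_inf.
have [t t_in ta] := a_rev; have tt := PGL2_reversor_involution a2 ta.
have ata : a * t * a = t.
  by rewrite -mulgA -[X in _ * X](mulgVK t) ta mulVKg.
(* Both factors of [a = t (t a)] are thus involutions; neither is trivial, as [a * a] would then be
   1. *)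
have ta2 : t * a * (t * a) = 1 by rewrite -mulgA (mulgA a) ata tt.
have [|i [h [ei h_in tE]]] := involution t t_in _ tt.
  by apply/eqP => t1; apply: a2; move: ata; rewrite t1 mulg1.
have [||j [k [ej k_in taE]]] := involution (t * a) _ _ ta2; first exact: gpredM.
  apply/eqP => t1; apply: a2; move: ata; rewrite -mulgA t1 mulg1 => aE.
  by rewrite -t1 -aE.
(* The involutions [t] and [t a] are conjugated by [h] and [k]; taking [h] out of their product
   leaves [h^-1 * k] around the second one. *)
exists i, j, h, (h^-1 * k); split=> //; first by rewrite gpredM ?gpredV.
have -> : a = t * (t * a) by rewrite mulgA tt mul1g.
by rewrite taE tE invgM invgK !mulgA mulgK.
Qed.
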